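(* Let $\rho_L, \rho_R \colon (S^1)^2 \to T$ be smooth homomorphisms given by $$\rho_L(t) = \mathrm{diag}(t^{w_1^L}, t^{w_2^L}, t^{w_3^L}), \qquad \rho_R(t) = \mathrm{diag}(t^{w_1^R}, t^{w_2^R}, t^{w_3^R}),$$ where $w_j^L, w_j^R \in \mathbb{Z}^2$ for $j=1,2,3$. Put $A_j := w_j^L - w_1^R$, $B_j := -w_j^L + w_3^R$ for $j=1,2,3$ and $C := -w_1^R + w_3^R$. Assume that $C \notin \mathrm{cone}(A_i, A_j)$, $C \notin \mathrm{cone}(B_i, B_j)$ and $C \in \mathrm{cone}(A_i, B_j)$ for all $i,j \in \{1,2,3\}$. Then the action of $(S^1)^2$ on $SU(3)$ given by $(\rho_L,\rho_R)$ is free if and only if $\rho_L$ is trivial and $\rho_R$ is an isomorphism.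
   Context: $T = \{\mathrm{diag}(g_1,g_2,g_3) \mid g_1,g_2,g_3 \in S^1,\ g_1g_2g_3 = 1\} \subset SU(3)$. The action of $(S^1)^2$ on $SU(3)$ given by $(\rho_L,\rho_R)$ is $t\cdot A = \rho_L(t)A\rho_R(t)^{-1}$. For $t=(t_1,t_2)\in (S^1)^2$ and $w=(w_1,w_2)\in\mathbb{Z}^2$, $t^w := t_1^{w_1}t_2^{w_2}$. For $s_1,\dots,s_k\in\mathbb{R}^2$, $\mathrm{cone}(s_1,\dots,s_k) = \{\sum_{j=1}^k \lambda_j s_j \mid \lambda_j \ge 0\}$. *)

(* Defs.v *)
From HB Require Import structures.
From mathcomp Require Import all_boot all_order all_algebra.
From mathcomp Require Import all_classical all_reals all_analysis.
From mathcomp.real_closed Require Import complex.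

Set Implicit Arguments.
Unset Strict Implicit.
Unset Printing Implicit Defensive.

Import Order.TTheory GRing.Theory Num.Theory.
Import numFieldNormedType.Exports.

Local Open Scope classical_set_scope.
Local Open Scope ring_scope.
Local Open Scope complex_scope.

(* For V finite-dimensional and U open, [Cn n U F] says that F is of class C^n
   on U; it is only used in that situation. *)
Fixpoint Cn (R : realType) (V W : normedModType R) (n : nat) (U : set V)
    (F : V -> W) : Prop :=
  match n with
  | 0 => {in U, continuous F}
  | n'.+1 => {in U, forall x, differentiable F x} /\
             forall v : V, Cn n' U (fun x => 'D_v F x)
  end.

(* Smoothness of f : X -> W on a subset A of X, where X and Y are placed in the
   Euclidean spaces V and W by the real coordinates cX and cY: near each point
   of A, f is the restriction of a C^oo map between open subsets of V and W.
   On an embedded submanifold this is smoothness in the sense of manifolds. *)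
Definition smooth_on (R : realType) (V W : normedModType R) (X Y : Type)
    (cX : X -> V) (cY : Y -> W) (A : set X) (f : X -> Y) : Prop :=
  forall x, A x -> exists (U : set V) (F : V -> W),
    [/\ open U, U (cX x), (forall n, Cn n U F) &
        forall y, A y -> U (cX y) -> F (cX y) = cY (f y)].

(* The groups below are subgroups of the unit groups of the rings C * C (with
   componentwise operations) and 'M[C]_3, so their products are ring products. *)
Definition smooth_hom (R : realType) (V W : normedModType R)
    (X Y : pzRingType) (cX : X -> V) (cY : Y -> W) (G : set X) (H : set Y)
    (f : X -> Y) : Prop :=
  [/\ set_fun G H f,
      {in G &, forall x y, f (x * y) = f x * f y} &
      smooth_on cX cY G f].

Definition lie_isomorphism (R : realType) (V W : normedModType R)
    (X Y : pzRingType) (cX : X -> V) (cY : Y -> W) (G : set X) (H : set Y)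
    (f : X -> Y) : Prop :=
  smooth_hom cX cY G H f /\
  exists g : Y -> X,
    [/\ smooth_hom cY cX H G g, {in G, cancel f g} & {in H, cancel g f}].

Section SU3.
Variable R : realType.
Local Notation C := R[i].

Definition pair_coord (t : C * C) : (R * R) * (R * R) :=
  ((complex.Re t.1, complex.Im t.1), (complex.Re t.2, complex.Im t.2)).

Definition mx_coord (A : 'M[C]_3) : 'M[R]_3 * 'M[R]_3 :=
  (map_mx (@complex.Re R) A, map_mx (@complex.Im R) A).

Definition circle : set C := [set z | `|z| = 1].

Definition torus2 : set (C * C) := circle `*` circle.

Definition SU3 : set 'M[C]_3 := [set A | A \is unitarymx /\ \det A = 1].

Definition maxtorus : set 'M[C]_3 :=
  [set A | exists g : 'I_3 -> C,
     [/\ forall j, circle (g j), \prod_j g j = 1 & A = diag_mx (\row_j g j)]].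

Definition character (t : C * C) (w : int * int) : C := t.1 ^ w.1 * t.2 ^ w.2.

Definition diag_character (w : 'I_3 -> int * int) (t : C * C) : 'M[C]_3 :=
  diag_mx (\row_j character t (w j)).

Definition torus_hom (rho : C * C -> 'M[C]_3) : Prop :=
  smooth_hom pair_coord mx_coord torus2 maxtorus rho.

Definition torus_iso (rho : C * C -> 'M[C]_3) : Prop :=
  lie_isomorphism pair_coord mx_coord torus2 maxtorus rho.

Definition trivial_hom (rho : C * C -> 'M[C]_3) : Prop :=
  {in torus2, forall t, rho t = 1}.

Definition biaction (rhoL rhoR : C * C -> 'M[C]_3) (t : C * C) (A : 'M[C]_3)
  : 'M[C]_3 := rhoL t *m A *m invmx (rhoR t).

Definition free_on (X : Type) (act : C * C -> X -> X) (S : set X) : Prop :=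
  forall t x, torus2 t -> S x -> act t x = x -> t = 1.

Definition cone (k : nat) (s : 'I_k -> R * R) : set (R * R) :=
  [set v | exists2 l : 'I_k -> R, (forall j, 0 <= l j) &
     v = \sum_j l j *: s j].

Definition cone2 (s1 s2 : R * R) : set (R * R) :=
  cone (tnth [tuple s1; s2]).

Definition realv (w : int * int) : R * R := (w.1%:~R, w.2%:~R).

End SU3.

Arguments circle : clear implicits.
Arguments torus2 : clear implicits.
Arguments SU3 : clear implicits.
Arguments maxtorus : clear implicits.
Arguments realv : clear implicits.

(* Main.v *)
From HB Require Import structures.
Require Import Defs.
From mathcomp Require Import all_boot all_order all_algebra.
From mathcomp Require Import perm cyclic separable cyclotomic.
From mathcomp Require Import all_classical all_reals all_analysis.
From mathcomp.real_closed Require Import complex.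
From mathcomp Require Import ring lra zify.

Import Order.TTheory GRing.Theory Num.Theory.
Import numFieldNormedType.Exports.
Local Open Scope classical_set_scope.
Local Open Scope ring_scope.
Local Open Scope complex_scope.

(** Write a_j, b_j for the weights of the left and right homomorphisms and
det(u, v) for the determinant of a pair of plane vectors.  Two diagonal
matrices are conjugate in SU(3) exactly when their entries agree up to a
permutation, and the conjugating matrix can then be taken to be a signed
permutation matrix.  A free action therefore forces, for all i <> j, that the
homomorphism t |-> (t^(a_i - b_1), t^(a_j - b_3)) = (t^(A_i), t^(-B_j)) of the
2-torus is injective; the third difference of weights is taken care of by the
determinant condition.  Testing on roots of unity, injectivity gives
det(B_j, A_i) = 1 or -1 ([free_differences], [injective_unimodular]).

The cone conditions fix these signs.  Since A_j + B_j = C, the exclusion of C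
from the rays of A_j and B_j gives det(B_j, A_j) <> 0, and writing
C = k A_i + l B_j with k, l >= 0 shows that det(B_j, A_i) has the sign of both
det(B_i, A_i) and det(B_j, A_j) ([cross_ray], [cross_cone]).  Hence, for i, j,
k distinct, det(B_j, A_i) = det(B_j, A_k) and det(B_i, A_j) = det(B_k, A_j),
so that A_i - A_k = B_k - B_i is parallel to both of the independent vectors
B_j and A_j, and vanishes ([unimodular_weights_eq]).  All a_i are then equal;
their sum is 0, so they are 0.  The remaining determinant is, up to sign,
det(b_1, b_3), and a unimodular pair of weights makes the right homomorphism
invertible ([unimodular_torus_iso]): the inverse is given by monomials in two
matrix entries, which become polynomial in the real coordinates because
inversion is complex conjugation on the circle.

Conversely, if the left homomorphism is trivial, a fixed point of t forces the
right homomorphism to send t to 1, whence t = 1. *)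

(** * Determinants and cones in the plane *)

Definition cross (T : pzRingType) (u v : T * T) : T := u.1 * v.2 - u.2 * v.1.
Arguments cross {T} u v.

Lemma cone2P (R : realType) (u v w : R * R) :
  cone2 u v w <->
  exists a b : R, [/\ 0 <= a, 0 <= b, w.1 = a * u.1 + b * v.1
                    & w.2 = a * u.2 + b * v.2].
Proof.
split=> [[l l_ge0 ->]|[a [b [a_ge0 b_ge0 w1 w2]]]].
  exists (l ord0), (l ord_max); split=> //; rewrite !big_ord_recl big_ord0 /=;
  rewrite (_ : lift ord0 ord0 = ord_max) ?addr0 //; exact/val_inj.
exists (fun j => if j == ord0 then a else b); first by move=> j; case: ifP.
by rewrite !big_ord_recl big_ord0 addr0 [LHS]surjective_pairing w1 w2.
Qed.

(** If A and B are parallel and A <> 0, say B = m A, then A + B is both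
(1 + m) A and ((1 + m) / m) B.  Either 1 + m >= 0, or m and 1 + m are both
negative and the second factor is positive. *)
Lemma cross_ray (R : realType) (A B : R * R) :
  ~ cone2 A A (A + B) -> ~ cone2 B B (A + B) -> cross B A != 0.
Proof.
case: A B => [a1 a2] [b1 b2] nA nB; apply/eqP; rewrite /cross /= => AB0.
have AB : a1 * b2 = a2 * b1 by lra.
have [A0|[m e1 e2]] : (a1 = 0 /\ a2 = 0) \/
    exists2 m, b1 = m * a1 & b2 = m * a2.
- have [a10|a1_neq0] := eqVneq a1 0.
    have [a20|a2_neq0] := eqVneq a2 0; first by left.
    right; exists (b2 / a2); last by rewrite divfK.
    apply: (mulfI a2_neq0); by rewrite -AB a10 mul0r !mulr0.
  right; exists (b1 / a1); first by rewrite divfK.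
  by apply: (mulfI a1_neq0); rewrite AB; field.
- apply: nB; apply/cone2P; exists 1, 0.
  by rewrite /= !mul1r !mul0r !addr0 A0.1 A0.2 !add0r.
have [m1_ge0|m1_lt0] := lerP 0 (1 + m).
  apply: nA; apply/cone2P; exists (1 + m), 0; rewrite /= e1 e2.
  by split=> //; ring.
have m_lt0 : m < 0 by lra.
apply: nB; apply/cone2P; exists ((1 + m) / m), 0; rewrite /= e1 e2.
split=> //; first by rewrite ltW // nmulr_rgt0 ?invr_lt0.
- by field; rewrite lt_eqF.
- by field; rewrite lt_eqF.
Qed.

(** Taking the determinant of A + B = k A + l B' with A, and of A' + B' with
B', gives det(B, A) = l det(B', A) and det(B', A') = k det(B', A). *)
Lemma cross_cone (R : realType) (A B A' B' : R * R) :
  A + B = A' + B' -> cross B A != 0 -> cross B' A' != 0 -> cone2 A B' (A + B) ->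
  (0 < cross B' A * cross B A) /\ (0 < cross B' A * cross B' A').
Proof.
move=> AB BA0 BA0' /cone2P[k [l [k_ge0 l_ge0 e1 e2]]].
have [eAB1 eAB2] : A.1 + B.1 = A'.1 + B'.1 /\ A.2 + B.2 = A'.2 + B'.2.
  by split; [exact: (congr1 fst AB) | exact: (congr1 snd AB)].
rewrite /= in e1 e2.
have eB : cross B A = l * cross B' A.
  have -> : B = (k * A.1 + l * B'.1 - A.1, k * A.2 + l * B'.2 - A.2).
    by rewrite [LHS]surjective_pairing; congr pair; lra.
  by rewrite /cross /=; ring.
have eB' : cross B' A' = k * cross B' A.
  have -> : A' = (k * A.1 + l * B'.1 - B'.1, k * A.2 + l * B'.2 - B'.2).
    by rewrite [LHS]surjective_pairing; congr pair; lra.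
  by rewrite /cross /=; ring.
move: BA0 BA0'; rewrite eB eB' !mulf_eq0 !negb_or => /andP[l0 c0] /andP[k0 _].
have c2 : 0 < cross B' A * cross B' A by rewrite -expr2 exprn_even_gt0.
by split; rewrite mulrCA pmulr_lgt0 // lt0r ?l0 ?k0.
Qed.

(** Cramer's rule: det(u, v) w = det(u, w) v - det(v, w) u. *)
Lemma cross_eq0 (T : idomainType) (u v w : T * T) :
  cross u v != 0 -> cross u w = 0 -> cross v w = 0 -> w = 0.
Proof.
case: u v w => [u1 u2] [v1 v2] [w1 w2]; rewrite /cross /= => uv0 uw vw.
congr pair; apply: (mulfI uv0); rewrite mulr0.
  (* The zeros are replaced by v * det(u, w) and u * det(v, w). *)
  by rewrite -[RHS](mulr0 v1) -uw -[LHS]addr0 -[X in _ + X](mulr0 u1) -vw; ring.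
by rewrite -[RHS](mulr0 v2) -uw -[LHS]addr0 -[X in _ + X](mulr0 u2) -vw; ring.
Qed.

(** * Weights with unimodular differences *)

Lemma realvD (R : realType) (u v : int * int) :
  realv R (u + v) = realv R u + realv R v.
Proof. by rewrite /realv /= !intrD. Qed.

Lemma cross_realv (R : realType) (u v : int * int) :
  cross (realv R u) (realv R v) = (cross u v)%:~R.
Proof. by rewrite /cross /realv /= intrB !intrM. Qed.

Lemma third_index (i k : 'I_3) : exists j : 'I_3, j != i /\ j != k.
Proof.
have /card_gt0P[j] : (0 < #|~: [set i; k]|)%N.
  by rewrite cardsCs finset.setCK card_ord cards2; case: (_ != _).
by rewrite !inE negb_or => /andP[]; exists j.
Qed.

Lemma unit_same_sign (x y d : int) :
  `|x| = 1 -> `|y| = 1 -> 0 < x * d -> 0 < y * d -> x = y.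
Proof.
move=> x1 y1.
have [->|->] : x = 1 \/ x = -1 by lia.
all: have [->|->] : y = 1 \/ y = -1 by lia.
all: by lia.
Qed.

(** The integers det(B_j, A_i) with i <> j are 1 or -1, and each has the sign
of det(B_i, A_i) and of det(B_j, A_j), so A_i - A_k is parallel to A_j and to
B_j when j is the third index; these two are independent. *)
Lemma unimodular_weights_eq (R : realType) (A B : 'I_3 -> int * int)
    (C : int * int) :
  (forall i, A i + B i = C) ->
  (forall i, ~ cone2 (realv R (A i)) (realv R (A i)) (realv R C)) ->
  (forall i, ~ cone2 (realv R (B i)) (realv R (B i)) (realv R C)) ->
  (forall i j, cone2 (realv R (A i)) (realv R (B j)) (realv R C)) ->
  (forall i j, i != j -> `|cross (B j) (A i)| = 1) ->
  forall i k, A i = A k.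
Proof.
move=> AB nA nB cAB unim i k.
have rAB l : realv R (A l) + realv R (B l) = realv R C by rewrite -realvD AB.
have D0 l : cross (realv R (B l)) (realv R (A l)) != 0.
  by apply: cross_ray; rewrite rAB.
have sgn p q : 0 < cross (B q) (A p) * cross (B p) (A p) /\
               0 < cross (B q) (A p) * cross (B q) (A q).
  have := @cross_cone R _ _ _ _ (etrans (rAB p) (esym (rAB q))) (D0 p) (D0 q).
  by rewrite rAB !cross_realv -!intrM !ltr0z; apply.
have [j [ji jk]] := third_index i k.
have ij : i != j by rewrite eq_sym.
have kj : k != j by rewrite eq_sym.
apply/eqP; rewrite -subr_eq0; apply/eqP.
apply: (@cross_eq0 _ (B j) (A j)).
- by have := D0 j; rewrite cross_realv intr_eq0.
- have := unit_same_sign _ _ _ (unim _ _ ij) (unim _ _ kj)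
    (sgn i j).2 (sgn k j).2.
  by rewrite /cross /=; lia.
- have := unit_same_sign _ _ _ (unim _ _ ji) (unim _ _ jk)
    (sgn j i).1 (sgn j k).1.
  have eB l : B l = C - A l by rewrite -(AB l) addrC addKr.
  by rewrite !eB /cross /=; lia.
Qed.

(** * Characters of the torus *)

Lemma circle_neq0 (R : realType) (z : R[i]) : circle R z -> z != 0.
Proof. by move=> z1; rewrite -normr_gt0 z1 ltr01. Qed.

Lemma circleX (R : realType) (z : R[i]) (n : int) :
  circle R z -> circle R (z ^ n).
Proof.
move=> z1; rewrite /circle /=; case: n => n; rewrite ?NegzE -?invr_expz ?normfV;
by rewrite normrX z1 expr1n ?invr1.
Qed.

Lemma circleM (R : realType) (z w : R[i]) :
  circle R z -> circle R w -> circle R (z * w).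
Proof. by move=> z1 w1; rewrite /circle /= normrM z1 w1 mulr1. Qed.

Lemma circleV_conj (R : realType) (z : R[i]) : circle R z -> z^-1 = z^*%C.
Proof. by move=> z1; rewrite invC_norm z1 expr1n invr1 mul1r. Qed.

Lemma circle_root (R : realType) (z : R[i]) (n : nat) :
  (0 < n)%N -> circle R (z ^+ n) -> circle R z.
Proof.
move=> n0; rewrite /circle /= normrX => /eqP.
by rewrite pexpr_eq1 // => /eqP.
Qed.

Lemma exprz_abs_eq1 (F : fieldType) (z : F) (n : int) :
  (z ^ n == 1) = (z ^+ `|n|%N == 1).
Proof. by case: n => n //; rewrite NegzE -invr_expz invr_eq1. Qed.

Lemma exists_prim_root (F : closedFieldType) (n : nat) :
  (n%:R : F) != 0 -> exists z : F, n.-primitive_root z.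
Proof.
move=> nF0; have n0 : (0 < n)%N by rewrite lt0n; apply: contra_neq nF0 => ->.
have [rs rsE] := closed_field_poly_normal ('X^n - 1 : {poly F}).
rewrite (monicP (monicXnsubC 1 n0)) scale1r in rsE.
have rs_root z : z \in rs = (n.-unity_root z).
  by rewrite /root_of_unity rsE root_prod_XsubC.
have /hasP[z _ zP] : has n.-primitive_root rs; last by exists z.
apply: has_prim_root => //.
- by apply/allP => z; rewrite rs_root.
- by rewrite -separable_prod_XsubC -rsE separable_Xn_sub_1.
- by rewrite -ltnS -(size_prod_XsubC rs id) -rsE size_XnsubC.
Qed.

(** For d <> 0 a primitive |d|-th root of unity decides divisibility; for
d = 0 the hypothesis bears on the whole circle, and an |n|-th root of -1
refutes z ^ n = 1. *)
Lemma circle_dvdz (R : realType) (d n : int) :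
  (forall z, circle R z -> z ^ d = 1 -> z ^ n = 1) -> (d %| n)%Z.
Proof.
move=> zdn; have [d0|d0] := eqVneq d 0.
  rewrite d0 dvd0z; apply: contraT => n0.
  have an0 : (0 < `|n|)%N by rewrite absz_gt0.
  pose z : R[i] := `|n|%N.-root (-1).
  have zn : z ^+ `|n| = -1 by rewrite rootCK.
  have /zdn : circle R z.
    by apply: circle_root an0 _; rewrite zn /circle /= normrN1.
  rewrite d0 expr0z => /(_ erefl) /eqP; rewrite exprz_abs_eq1 zn.
  by rewrite lt_eqF // (lt_trans (ltrN10 _) ltr01).
have ad0 : (0 < `|d|)%N by rewrite absz_gt0.
have [|z zP] := @exists_prim_root R[i] `|d|%N; first by rewrite pnatr_eq0 -lt0n.
rewrite dvdzE (prim_order_dvd zP) -exprz_abs_eq1; apply/eqP/zdn.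
  by apply: circle_root ad0 _; rewrite prim_expr_order// /circle /= normr1.
by apply/eqP; rewrite exprz_abs_eq1 prim_expr_order.
Qed.

Lemma character_eq1 (R : realType) (w : int * int) :
  (forall t, torus2 R t -> character t w = 1) -> w = 0.
Proof.
move=> w1; have c1 : circle R 1 by rewrite /circle /= normr1.
have : (0 %| w.1)%Z /\ (0 %| w.2)%Z.
  split; apply: (@circle_dvdz R) => z zc _.
    by rewrite -(w1 (z, 1)) // /character /= exp1rz mulr1.
  by rewrite -(w1 (1, z)) // /character /= exp1rz mul1r.
by case: w {w1} => w1 w2; rewrite !dvd0z /= => -[/eqP-> /eqP->].
Qed.

Lemma characterD (R : realType) (t : R[i] * R[i]) (v w : int * int) :
  torus2 R t -> character t (v + w) = character t v * character t w.
Proof.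
case=> /circle_neq0 t1 /circle_neq0 t2.
by rewrite /character /= !expfzDr // mulrACA.
Qed.

Lemma character0 (R : realType) (t : R[i] * R[i]) : character t 0 = 1.
Proof. by rewrite /character !expr0z mulr1. Qed.

Lemma characterN (R : realType) (t : R[i] * R[i]) (w : int * int) :
  character t (- w) = (character t w)^-1.
Proof. by rewrite /character /= -!invr_expz invfM. Qed.

Lemma character_circle (R : realType) (t : R[i] * R[i]) (w : int * int) :
  torus2 R t -> circle R (character t w).
Proof. by case=> t1 t2; apply: circleM; apply: circleX. Qed.

(** Let d = det(u, v).  For every z with z ^ d = 1 the points (z ^ v.2,
z ^ -v.1) and (z ^ u.2, z ^ -u.1) lie in the kernel of t |-> (t ^ u, t ^ v),
so d divides all four entries of u and v, and d ^ 2 divides d.  If d = 0, the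
same argument with z running over the circle gives u = v = 0, and (-1, 1) is
in the kernel. *)
Lemma injective_unimodular (R : realType) (u v : int * int) :
  (forall t, torus2 R t -> character t u = 1 -> character t v = 1 -> t = 1) ->
  `|cross u v| = 1.
Proof.
move=> inj; set d := cross u v.
have kill p q : (d %| p * u.1 + q * u.2)%Z -> (d %| p * v.1 + q * v.2)%Z ->
    (d %| p)%Z /\ (d %| q)%Z.
  move=> du dv.
  have sub z : circle R z -> z ^ d = 1 -> (z ^ p, z ^ q) = 1.
    move=> zc zd; have z0 := circle_neq0 _ _ zc.
    have trivial_on w : (d %| p * w.1 + q * w.2)%Z ->
        character (z ^ p, z ^ q) w = 1.
      case/dvdzP => m e; rewrite /character /= !exprz_exp -expfzDr // e mulrC.
      by rewrite -exprz_exp zd exp1rz.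
    by apply: inj; [split; apply: circleX | apply: trivial_on..].
  by split; apply: (@circle_dvdz R) => z zc zd; have [] := sub z zc zd.
have [|| /dvdzP[a ea] /dvdzP[b eb]] := kill v.2 (- v.1).
- by rewrite (_ : _ + _ = d) // /d /cross; ring.
- by rewrite (_ : _ + _ = 0) ?dvdz0 //; ring.
have [|| /dvdzP[a' ea'] /dvdzP[b' eb']] := kill u.2 (- u.1).
- by rewrite (_ : _ + _ = 0) ?dvdz0 //; ring.
- by rewrite (_ : _ + _ = - d) ?dvdzE ?abszN //= /d /cross; ring.
have dd : d * (1 - d * (a * - b' + a' * b)) = 0.
  have : d = a * d * - (b' * d) + a' * d * (b * d).
    by rewrite -ea -eb -ea' -eb' /d /cross; ring.
  by move=> e; rewrite mulrBr mulr1 {1}e; ring.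
move/eqP: dd; rewrite mulf_eq0 => /orP[/eqP d0|].
  have c1 : circle R 1 by rewrite /circle /= normr1.
  have cN : circle R (-1) by rewrite /circle /= normrN1.
  have w0 (w : int * int) : w.1 = 0 -> character (-1, 1 : R[i]) w = 1.
    by rewrite /character /= => ->; rewrite expr0z exp1rz mulr1.
  have [] : (-1, 1) = 1 :> R[i] * R[i].
    by apply: inj => //; apply: w0; lia.
  by move/eqP; rewrite lt_eqF // (lt_trans (ltrN10 _) ltr01).
rewrite subr_eq0 => /eqP e.
have : (d %| 1)%Z by rewrite [X in (_ %| X)%Z]e dvdz_mulr.
by rewrite dvdz1 -abszE => /eqP ->.
Qed.

(** * Conjugating diagonal matrices by permutations *)

Lemma perm_to_ends (i j : 'I_3) :
  i != j -> exists s : 'S_3, s i = ord0 /\ s j = ord_max.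
Proof.
move=> ij; exists (tperm i ord0 * tperm (tperm i ord0 j) ord_max)%g.
rewrite !permM !tpermL; split=> //; set x := tperm i ord0 j.
have x0 : x != ord0 by rewrite -(tpermL i ord0) (inj_eq perm_inj) eq_sym.
by rewrite tpermD.
Qed.

(** The size is odd, so multiplying by the signature corrects the
determinant. *)
Lemma signed_perm_SU3 (R : realType) (s : 'S_3) :
  SU3 R ((-1) ^+ s *: perm_mx s).
Proof.
split; last by rewrite detZ det_perm; case: (odd_perm s); rewrite /=; ring.
apply/unitarymxP; rewrite linearZ /= map_mxZ tr_perm_mx map_perm_mx.
rewrite -scalemxAl -scalemxAr scalerA -perm_mxM mulgV perm_mx1.
rewrite rmorphXn rmorphN1 -exprD addnn -mul2n exprM sqrrN.
by rewrite !expr1n scale1r.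
Qed.

Lemma fixed_signed_perm (R : realType) (s : 'S_3) (c : R[i])
    (a b : 'I_3 -> R[i]) :
  (forall i, a i = b (s i)) -> diag_mx (\row_j b j) \in unitmx ->
  diag_mx (\row_j a j) *m (c *: perm_mx s) *m invmx (diag_mx (\row_j b j))
    = c *: perm_mx s.
Proof.
move=> ab bU; apply: (canLR (mulmxK bU)).
apply/matrixP => i j; rewrite mul_diag_mx mul_mx_diag !mxE ab.
by have [->|] := eqVneq (s i) j; [rewrite mulrC | rewrite !mulr0 mul0r].
Qed.

Lemma maxtorus_unitmx (R : realType) (A : 'M[R[i]]_3) :
  maxtorus R A -> A \in unitmx.
Proof.
case=> g [_ g1 ->].
by rewrite unitmxE det_diag (eq_bigr g) ?g1 ?unitr1 // => j _; rewrite mxE.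
Qed.

Lemma weights_sum0 (R : realType) (rho : R[i] * R[i] -> 'M[R[i]]_3)
    (w : 'I_3 -> int * int) :
  set_fun (torus2 R) (maxtorus R) rho ->
  {in torus2 R, rho =1 diag_character w} -> \sum_j w j = 0.
Proof.
move=> rhoT rhoE; apply: (@character_eq1 R) => t tT.
have [g [_ g1]] := rhoT t tT; rewrite rhoE ?inE // => /matrixP e.
rewrite -g1 (big_morph (character t) (fun x y => characterD _ t x y tT)
  (character0 _ t)).
by apply: eq_bigr => j _; have := e j j; rewrite !mxE eqxx !mulr1n.
Qed.

(** Choose a permutation s sending i to the first and j to the last index.  If
t kills the two differences of weights, then it kills wL l - wR (s l) for the
third index l too, as the weights on each side have sum 0; the signed
permutation matrix of s is then fixed by t. *)
Lemma free_differences (R : realType) (rhoL rhoR : R[i] * R[i] -> 'M[R[i]]_3)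
    (wL wR : 'I_3 -> int * int) :
  set_fun (torus2 R) (maxtorus R) rhoL ->
  set_fun (torus2 R) (maxtorus R) rhoR ->
  {in torus2 R, rhoL =1 diag_character wL} ->
  {in torus2 R, rhoR =1 diag_character wR} ->
  free_on (biaction rhoL rhoR) (SU3 R) ->
  forall i j, i != j ->
    `|cross (- wL j + wR ord_max) (wL i - wR ord0)| = 1.
Proof.
move=> rhoLT rhoRT rhoLE rhoRE free i j ij.
apply: (@injective_unimodular R) => t tT tj ti.
have [s [si sj]] := perm_to_ends _ _ ij.
apply: (free t _ tT (signed_perm_SU3 R s)).
have tT' : t \in torus2 R by rewrite inE.
have := maxtorus_unitmx _ _ (rhoRT t tT).
rewrite /biaction rhoLE ?rhoRE //; apply: fixed_signed_perm => l.
pose f k := wL k - wR (s k).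
have f0 : \sum_k f k = 0.
  transitivity (\sum_j wL j - \sum_j wR j); last first.
    by rewrite (weights_sum0 _ _ _ rhoLT) // (weights_sum0 _ _ _ rhoRT) ?subr0.
  rewrite /f sumrB; congr (_ - _).
  by rewrite [RHS](reindex_inj (@perm_inj _ s)).
have fi : character t (f i) = 1 by rewrite /f si.
have fj : character t (f j) = 1.
  by rewrite /f sj -opprB addrC characterN tj invr1.
suff : character t (f l) = 1.
  by rewrite characterD // characterN => /divr1_eq.
have [->//|li] := eqVneq l i; have [->//|lj] := eqVneq l j.
rewrite -[RHS](character0 _ t) -f0 (bigD1 l) //= [RHS]characterD //.
rewrite (big_morph (character t) (fun x y => characterD _ t x y tT)
  (character0 _ t)) big1 ?mulr1 // => k kl.
(* Only i and j are left as values of k. *)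
have [->//|ki] := eqVneq k i; have [->//|kj] := eqVneq k j.
move: (ltn_ord i) (ltn_ord j) (ltn_ord k) (ltn_ord l).
move: ij li lj kl ki kj; rewrite -!val_eqE /=; lia.
Qed.

(** * Polynomial maps are smooth *)

Section Smoothness.
Variables (R : realType) (V : normedModType R).

(** This class is closed under directional derivatives, which reduces
smoothness to differentiability. *)
Inductive polynomial_fun : (V -> R) -> Prop :=
| PolynomialCst c : polynomial_fun (fun=> c)
| PolynomialLinear (f : {linear V -> R}) : continuous f -> polynomial_fun f
| PolynomialD f g : polynomial_fun f -> polynomial_fun g ->
    polynomial_fun (fun x => f x + g x)
| PolynomialM f g : polynomial_fun f -> polynomial_fun g ->
    polynomial_fun (fun x => f x * g x).

Lemma polynomial_differentiable f :
  polynomial_fun f -> forall x, differentiable f x.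
Proof.
elim=> [c|{}f cf|{}f g _ df _ dg|{}f g _ df _ dg] x.
- exact: differentiable_cst.
- exact: linear_differentiable.
- exact: differentiableD.
- exact: differentiableM.
Qed.

Lemma eq_polynomial (f g : V -> R) :
  f =1 g -> polynomial_fun f -> polynomial_fun g.
Proof. by move=> /funext ->. Qed.

Lemma polynomial_derive f v :
  polynomial_fun f -> polynomial_fun (fun x => 'D_v f x).
Proof.
elim=> [c|{}f cf|{}f g pf df pg dg|{}f g pf df pg dg].
- apply: (@eq_polynomial (fun=> 0)); last exact: PolynomialCst.
  by move=> x; rewrite derive_cst.
- apply: (@eq_polynomial (fun=> f v)); last exact: PolynomialCst.
  by move=> x; rewrite deriveE ?diff_lin//; exact: linear_differentiable.
- apply: eq_polynomial (PolynomialD _ _ df dg) => x.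
  by rewrite deriveD //; apply/diff_derivable/polynomial_differentiable.
- apply: eq_polynomial
    (PolynomialD _ _ (PolynomialM _ _ pf dg) (PolynomialM _ _ pg df)) => x.
  by rewrite deriveM //; apply/diff_derivable/polynomial_differentiable.
Qed.

Lemma polynomial_Cn n f : polynomial_fun f -> Cn n setT f.
Proof.
elim: n f => [|n IH] f pf /=.
  by move=> x _; apply/differentiable_continuous/polynomial_differentiable.
split=> [x _|v]; first exact: polynomial_differentiable.
exact/IH/polynomial_derive.
Qed.

Lemma Cn_pair (W W' : normedModType R) n (f : V -> W) (g : V -> W') :
  Cn n setT f -> Cn n setT g -> Cn n setT (fun x => (f x, g x)).
Proof.
elim: n f g => [|n IH] f g /=.
  by move=> cf cg x xT; apply: cvg_pair; [apply: cf | apply: cg].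
move=> [df Df] [dg Dg]; split=> [x xT|v].
  by apply: differentiable_pair; [apply: df | apply: dg].
have -> : (fun x => 'D_v (fun y => (f y, g y)) x) =
    (fun x => ('D_v f x, 'D_v g x)); last exact: IH.
apply/funext => x.
have [dfx dgx] : differentiable f x /\ differentiable g x.
  by split; [apply: df | apply: dg]; rewrite inE.
by rewrite !deriveE ?diff_pair //; apply: differentiable_pair.
Qed.

Definition complex_polynomial_fun (h : V -> R[i]) : Prop :=
  polynomial_fun (fun x => complex.Re (h x)) /\
  polynomial_fun (fun x => complex.Im (h x)).

Lemma complex_polynomialM h k :
  complex_polynomial_fun h -> complex_polynomial_fun k ->
  complex_polynomial_fun (fun x => h x * k x).
Proof.
move=> [hr hi] [kr ki]; split.
  apply: eq_polynomial (PolynomialD _ _ (PolynomialM _ _ hr kr)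
    (PolynomialM _ _ (PolynomialCst (-1)) (PolynomialM _ _ hi ki))) => x.
  by rewrite mulN1r; case: (h x) (k x) => [a b] [c d].
apply: eq_polynomial
  (PolynomialD _ _ (PolynomialM _ _ hr ki) (PolynomialM _ _ hi kr)) => x.
by case: (h x) (k x) => [a b] [c d].
Qed.

Lemma complex_polynomial_conj h :
  complex_polynomial_fun h -> complex_polynomial_fun (fun x => (h x)^*%C).
Proof.
move=> [hr hi]; split.
  by apply: eq_polynomial hr => x; case: (h x).
apply: eq_polynomial (PolynomialM _ _ (PolynomialCst (-1)) hi) => x.
by rewrite mulN1r; case: (h x).
Qed.

Lemma complex_polynomialX h n :
  complex_polynomial_fun h -> complex_polynomial_fun (fun x => h x ^+ n).
Proof.
move=> ph; elim: n => [|n IH].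
  by split; apply: PolynomialCst.
have -> : (fun x => h x ^+ n.+1) = (fun x => h x * h x ^+ n).
  by apply/funext => x; rewrite exprS.
exact: complex_polynomialM.
Qed.

End Smoothness.

Arguments complex_polynomial_fun {R V}.

(** An integer power on the circle that is polynomial in the real and
imaginary parts on the whole plane: negative powers are powers of the
conjugate. *)
Definition conj_power (R : realType) (z : R[i]) (n : int) : R[i] :=
  match n with Posz k => z ^+ k | Negz k => (z^*%C) ^+ k.+1 end.
Arguments conj_power {R}.

Lemma conj_power_circle (R : realType) (z : R[i]) n :
  circle R z -> conj_power z n = z ^ n.
Proof.
move=> zc; case: n => // n.
by rewrite /= NegzE -invr_expz -circleV_conj // exprVn.
Qed.

Lemma complex_polynomial_conj_power (R : realType) (V : normedModType R)
    (h : V -> R[i]) n :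
  complex_polynomial_fun h ->
  complex_polynomial_fun (fun x => conj_power (h x) n).
Proof.
by move=> ph; case: n => n; apply: complex_polynomialX => //;
  apply: complex_polynomial_conj.
Qed.

(** Two entries of a diagonal matrix of determinant 1 determine the third, so
all continuous homomorphisms from the maximal torus to the 2-torus have this
shape. *)
Definition corner_monomials (R : realType) (p q : int * int) (M : 'M[R[i]]_3)
  : R[i] * R[i] :=
  (conj_power (M ord0 ord0) p.1 * conj_power (M ord_max ord_max) p.2,
   conj_power (M ord0 ord0) q.1 * conj_power (M ord_max ord_max) q.2).
Arguments corner_monomials {R}.

Lemma corner_monomials_smooth (R : realType) p q :
  smooth_on (@mx_coord R) (@pair_coord R) (maxtorus R) (corner_monomials p q).
Proof.
move=> M _; pose V : normedModType R := ('M[R]_3 * 'M[R]_3)%type.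
(* The map must be defined on all pairs of real matrices, so the matrix is
   rebuilt from its real coordinates. *)
pose rec (x : V) : 'M[R[i]]_3 := \matrix_(i, j) (x.1 i j +i* x.2 i j).
have recK A : rec (mx_coord A) = A.
  by apply/matrixP => i j; rewrite !mxE; case: (A i j).
exists setT, (fun x => pair_coord (corner_monomials p q (rec x))).
split; [exact: openT | by [] | | by move=> A _ _; rewrite recK].
move=> n.
have rec_poly i j : complex_polynomial_fun (fun x => rec x i j).
  pose re (x : V) : R := x.1 i j.
  pose im (x : V) : R := x.2 i j.
  have re_lin : linear re by move=> a x y; rewrite /re !mxE.
  have im_lin : linear im by move=> a x y; rewrite /im !mxE.
  pose reL : {linear V -> R} :=
    HB.pack re (GRing.isLinear.Build _ _ _ _ _ re_lin).
  pose imL : {linear V -> R} :=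
    HB.pack im (GRing.isLinear.Build _ _ _ _ _ im_lin).
  have coord_cont : continuous (fun A : 'M[R]_3 => A i j).
    exact: coord_continuous.
  have re_cont : continuous reL.
    move=> x; apply: (@continuous_comp V _ _ fst (fun A : 'M[R]_3 => A i j)).
      exact: cvg_fst.
    exact: coord_cont.
  have im_cont : continuous imL.
    move=> x; apply: (@continuous_comp V _ _ snd (fun A : 'M[R]_3 => A i j)).
      exact: cvg_snd.
    exact: coord_cont.
  split.
    by apply: eq_polynomial (PolynomialLinear _ _ _ re_cont) => x; rewrite mxE.
  by apply: eq_polynomial (PolynomialLinear _ _ _ im_cont) => x; rewrite mxE.
have monom_poly w : complex_polynomial_fun (fun x =>
    conj_power (rec x ord0 ord0) w.1 * conj_power (rec x ord_max ord_max) w.2).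
  by apply: complex_polynomialM; apply: complex_polynomial_conj_power.
have [pr pi] := monom_poly p; have [qr qi] := monom_poly q.
by do !apply: Cn_pair; apply: polynomial_Cn.
Qed.

(** * The inverse of a unimodular homomorphism, and the theorem *)

Lemma maxtorus_corners (R : realType) (M : 'M[R[i]]_3) :
  maxtorus R M -> torus2 R (M ord0 ord0, M ord_max ord_max).
Proof. by case=> g [gc _ ->]; rewrite !mxE !eqxx !mulr1n; split; apply: gc. Qed.

Lemma corner_monomialsE (R : realType) (p q : int * int) (M : 'M[R[i]]_3) :
  maxtorus R M ->
  corner_monomials p q M = (character (M ord0 ord0, M ord_max ord_max) p,
                            character (M ord0 ord0, M ord_max ord_max) q).
Proof.
case/maxtorus_corners => /= xc yc.
by rewrite /corner_monomials !conj_power_circle.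
Qed.

Lemma characterM (R : realType) (s t : R[i] * R[i]) (w : int * int) :
  character (s * t) w = character s w * character t w.
Proof. by rewrite /character !expfzMl mulrACA. Qed.

Lemma corner_monomials_hom (R : realType) (p q : int * int) :
  smooth_hom (@mx_coord R) (@pair_coord R) (maxtorus R) (torus2 R)
    (corner_monomials p q).
Proof.
split; last exact: corner_monomials_smooth.
  move=> M MT; rewrite corner_monomialsE //.
  by split; apply: character_circle (maxtorus_corners _ _ MT).
move=> M N /set_mem MT /set_mem NT.
set P := (X in corner_monomials p q X = _).
have [PT Pdiag] : maxtorus R P /\ forall i, P i i = M i i * N i i.
  rewrite {}/P; case: MT NT => [g [gc g1 ->]] [h [hc h1 ->]].
  have -> : diag_mx (\row_j g j) * diag_mx (\row_j h j) =
      diag_mx (\row_j (g j * h j)).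
    by rewrite [LHS]mulmx_diag; congr diag_mx; apply/rowP => j; rewrite !mxE.
  split; last by move=> i; rewrite !mxE eqxx !mulr1n.
  exists (fun j => g j * h j); split=> //.
    by move=> j; apply: circleM.
  by rewrite big_split /= g1 h1 mulr1.
rewrite !corner_monomialsE // !Pdiag.
by congr pair; rewrite -characterM.
Qed.

(** Composing characters multiplies the matrix with rows p, q by w on the
left. *)
Lemma character_comp (R : realType) (s : R[i] * R[i]) (p q w : int * int) :
  torus2 R s ->
  character (character s p, character s q) w =
  character s (w.1 * p.1 + w.2 * q.1, w.1 * p.2 + w.2 * q.2).
Proof.
case=> /circle_neq0 s1 /circle_neq0 s2; rewrite /character /=.
rewrite !expfzDr // !expfzMl !exprz_exp !(mulrC w.1) !(mulrC w.2).
by rewrite mulrACA.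
Qed.

(** The inverse of the integer matrix with rows u = w ord0 and v = w ord_max,
of determinant d = 1 or -1, has rows p and q below; characters with exponents
p and q of the two corner entries recover t.  The middle entry is the inverse
of the product of the other two, on both sides. *)
Lemma unimodular_torus_iso (R : realType) (rho : R[i] * R[i] -> 'M[R[i]]_3)
    (w : 'I_3 -> int * int) :
  torus_hom rho -> {in torus2 R, rho =1 diag_character w} ->
  `|cross (w ord0) (w ord_max)| = 1 -> torus_iso rho.
Proof.
move=> hom rhoE unim; split=> //; have [rhoT _ _] := hom.
set u := w ord0 in unim; set v := w ord_max in unim; set d := cross u v in unim.
have dd : d * d = 1.
  by have [->|->] : d = 1 \/ d = -1 by lia.
have dE : u.1 * v.2 - u.2 * v.1 = d by [].
(* As d ^-1 = d, this is the adjugate matrix multiplied by d. *)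
pose p := (d * v.2, - (d * u.2)); pose q := (- (d * v.1), d * u.1).
have rho_diag t i : torus2 R t -> rho t i i = character t (w i).
  by move=> tT; rewrite rhoE ?inE // !mxE eqxx mulr1n.
exists (corner_monomials p q); split; first exact: corner_monomials_hom.
  move=> t /set_mem tT; rewrite corner_monomialsE ?rho_diag //; last first.
    exact: rhoT.
  rewrite !character_comp // -/u -/v [RHS]surjective_pairing.
  congr pair.
    rewrite (_ : (_, _) = (1, 0)).
      by rewrite /character /= expr1z expr0z mulr1.
    by congr pair => /=; rewrite -?dd -?dE; ring.
  rewrite (_ : (_, _) = (0, 1)).
    by rewrite /character /= expr1z expr0z mul1r.
  by congr pair => /=; rewrite -?dd -?dE; ring.
move=> M /set_mem MT; have sT := maxtorus_corners _ _ MT.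
rewrite corner_monomialsE //; set s := (_, _) in sT *; set t := (_, _).
have tT : torus2 R t by split; apply: character_circle.
have t0 : character t u = M ord0 ord0.
  rewrite character_comp // (_ : (_, _) = (1, 0)).
    by rewrite /character /= expr1z expr0z mulr1.
  by congr pair => /=; rewrite -?dd -?dE; ring.
have t2 : character t v = M ord_max ord_max.
  rewrite character_comp // (_ : (_, _) = (0, 1)).
    by rewrite /character /= expr1z expr0z mul1r.
  by congr pair => /=; rewrite -?dd -?dE; ring.
case: MT t0 t2 => g [gc g1 ->]; rewrite !mxE !eqxx !mulr1n => t0 t2.
have wsum := weights_sum0 _ _ _ rhoT rhoE.
have t1 : \prod_j character t (w j) = \prod_j g j.
  rewrite g1 -[RHS](character0 _ t) -wsum.
  by rewrite (big_morph (character t) (fun x y => characterD _ t x y tT)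
    (character0 _ t)).
rewrite rhoE ?inE //; congr diag_mx; apply/rowP => j; rewrite !mxE.
have [->//|j0] := eqVneq j ord0; have [->//|j2] := eqVneq j ord_max.
have jE : j = lift ord0 ord0.
  apply/val_inj; move: (ltn_ord j) j0 j2; rewrite -!val_eqE /= ?/bump /=; lia.
have maxE : lift ord0 (lift ord0 ord0) = ord_max :> 'I_3 by exact/val_inj.
move: t1; rewrite !big_ord_recl !big_ord0 !maxE -jE !mulr1 -/u -/v t0 t2.
by move/(mulfI (circle_neq0 _ _ (gc _)))/(mulIf (circle_neq0 _ _ (gc _))).
Qed.

Theorem proposition5p3 (R : realType)
    (rhoL rhoR : R[i] * R[i] -> 'M[R[i]]_3)
    (wL wR : 'I_3 -> int * int)
    (homL : torus_hom rhoL) (homR : torus_hom rhoR)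
    (rhoLE : {in torus2 R, rhoL =1 diag_character wL})
    (rhoRE : {in torus2 R, rhoR =1 diag_character wR}) :
  let A (j : 'I_3) : R * R := realv R (wL j - wR ord0) in
  let B (j : 'I_3) : R * R := realv R (- wL j + wR ord_max) in
  let C : R * R := realv R (- wR ord0 + wR ord_max) in
  (forall i j : 'I_3,
     [/\ ~ cone2 (A i) (A j) C, ~ cone2 (B i) (B j) C &
         cone2 (A i) (B j) C]) ->
  (free_on (biaction rhoL rhoR) (SU3 R) <->
   trivial_hom rhoL /\ torus_iso rhoR).
Proof.
move=> A B C cones; have [rhoLT _ _] := homL; have [rhoRT _ _] := homR.
have one_torus : torus2 R 1 by split; rewrite /circle /= normr1.
have diag_1 (w : 'I_3 -> int * int) t : (forall j, character t (w j) = 1) ->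
    diag_character w t = 1 :> 'M[R[i]]_3.
  move=> w1; rewrite /diag_character (_ : \row_j _ = const_mx 1).
    exact: diag_const_mx.
  by apply/rowP => j; rewrite !mxE w1.
split=> [free|[rhoL1 [_ [g [_ rhoRK _]]]] t x tT [xU _]]; last first.
  have tT' : t \in torus2 R by rewrite inE.
  rewrite /biaction rhoL1 // mul1mx -[RHS]mulmx1.
  move/(can_inj (mulKmx (unitarymx_unit xU))) => /(congr1 invmx).
  rewrite invmxK invmx1 => rhoRt1.
  rewrite -(rhoRK t) // rhoRt1 -(rhoRK 1) ?inE //; congr g.
  by rewrite rhoRE ?inE // diag_1 // => j; rewrite /character !exp1rz mulr1.
have unim := free_differences _ _ _ _ _ rhoLT rhoRT rhoLE rhoRE free.
have eqA : forall i k, wL i - wR ord0 = wL k - wR ord0.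
  apply: (@unimodular_weights_eq R _ (fun j => - wL j + wR ord_max)
    (- wR ord0 + wR ord_max)) => [i|i|i|i j|//].
  - by rewrite addrAC addrA subrr add0r addrC.
  - by have [] := cones i i.
  - by have [] := cones i i.
  - by have [] := cones i j.
have wL0 j : wL j = 0.
  have := weights_sum0 _ _ _ rhoLT rhoLE.
  rewrite (eq_bigr (fun=> wL j)) => [|k _]; last exact: (addIr _ (eqA k j)).
  rewrite sumr_const card_ord; case: (wL j) => a b /= [ha hb].
  by congr pair; lia.
split.
  by move=> t tT; rewrite rhoLE // diag_1 // => j; rewrite wL0 character0.
apply: (unimodular_torus_iso _ _ wR) => //.
have := unim ord0 ord_max isT; rewrite !wL0 oppr0 !add0r.
rewrite (_ : cross _ _ = cross (wR ord0) (wR ord_max)) //.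
by rewrite /cross /=; ring.
Qed.
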